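(* Let $\mathcal M$ be a smooth manifold and suppose that $T\mathcal M$ (equivalently the module $\mathfrak X(\mathcal M)$ of vector fields) has a direct sum decomposition into $N$ submodules (or distributions) with corresponding projectors $P_A$, $A=1,\dots,N$. Suppose that for each $A$ the submodule $\operatorname{im}(P_A)$ has a (non-trivial) submodule covariant derivative $\nabla^A$, and let $\bar\nabla^A$ be its extension, defined for $X\in\mathfrak X(\mathcal M)$ and $Y\in\operatorname{im}(P_A)$ by $$\bar\nabla^A_XY:=\nabla^A_{P_A(X)}Y+P_A([X-P_A(X),Y]).$$ Then $$\nabla_XY:=\sum_{A=1}^N\bar\nabla^A_X(P_A(Y)),\qquad X,Y\in\mathfrak X(\mathcal M),$$ has the covariant derivative properties over $C^\infty(\mathcal M)$: it is $\mathbb R$-linear in both arguments and, for all $f\in C^\infty(\mathcal M)$ and $X,Y\in\mathfrak X(\mathcal M)$, $$\nabla_{fX}Y=f\nabla_XY,\qquad \nabla_X(fY)=X(f)Y+f\nabla_XY.$$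
   Context: $\mathfrak X(\mathcal M)$ is the $C^\infty(\mathcal M)$-module of smooth vector fields on $\mathcal M$. The projectors $P_A:\mathfrak X(\mathcal M)\to\mathfrak X(\mathcal M)$ are $C^\infty(\mathcal M)$-linear with $P_A^2=P_A$, $P_A\circ P_B=0$ for $A\ne B$, and $\sum_{A=1}^NP_A=I$. A submodule covariant derivative on $\operatorname{im}(P)$ is a map $(X,Y)\mapsto\nabla^P_XY\in\mathfrak X(\mathcal M)$, defined for $X,Y\in\operatorname{im}(P)$, that is $\mathbb R$-linear in both arguments and satisfies $\nabla^P_{fX}Y=f\nabla^P_XY$ and $\nabla^P_X(fY)=X(f)Y+f\nabla^P_XY$ for all $f\in C^\infty(\mathcal M)$. It is not required that $\nabla^P_XY\in\operatorname{im}(P)$. The parenthetical qualifier ''(non-trivial)'' is the source's own wording; the source gives it no further definition. *)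

(* Defs.v *)
From HB Require Import structures.
From mathcomp Require Import all_boot all_order all_algebra.
From mathcomp Require Import all_classical all_reals.
From mathcomp Require Import topology normedtype derive.
From mathcomp Require Import ring.

Set Implicit Arguments.
Unset Strict Implicit.
Unset Printing Implicit Defensive.

Import Order.TTheory GRing.Theory Num.Theory.
Import numFieldNormedType.Exports.

Local Open Scope classical_set_scope.
Local Open Scope ring_scope.

(* [Ck k U f]: all iterated partial derivatives of f of order at most k exist
   and are continuous on U. Only meant for U open, where continuity at every
   point of U is the same as continuity for the subspace topology. *)
Fixpoint Ck (R : realType) (n : nat) (W : normedModType R) (k : nat)
    (U : set 'rV[R]_n) (f : 'rV[R]_n -> W) : Prop :=
  (forall x, U x -> {for x, continuous f}) /\
  if k is k'.+1 then
    forall i : 'I_n,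
      (forall x, U x -> derivable f x (delta_mx 0 i)) /\
      Ck k' U (fun x => 'D_(delta_mx 0 i) f x)
  else True.

Definition smooth_on (R : realType) (n : nat) (W : normedModType R)
    (U : set 'rV[R]_n) (f : 'rV[R]_n -> W) : Prop :=
  forall k, Ck k U f.

(* A chart is a homeomorphism between an open subset of M and an open subset
   of R^n; chart_map and chart_inv are total functions whose values outside
   chart_dom and chart_cod are irrelevant. *)
Record chart (R : realType) (n : nat) (M : topologicalType) := Chart {
  chart_dom : set M;
  chart_cod : set 'rV[R]_n;
  chart_map : M -> 'rV[R]_n;
  chart_inv : 'rV[R]_n -> M;
  chart_dom_open : open chart_dom;
  chart_cod_open : open chart_cod;
  chart_map_cod : forall p, chart_dom p -> chart_cod (chart_map p);
  chart_inv_dom : forall x, chart_cod x -> chart_dom (chart_inv x);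
  chart_mapK : forall p, chart_dom p -> chart_inv (chart_map p) = p;
  chart_invK : forall x, chart_cod x -> chart_map (chart_inv x) = x;
  chart_map_continuous :
    forall p, chart_dom p -> {for p, continuous chart_map};
  chart_inv_continuous :
    forall x, chart_cod x -> {for x, continuous chart_inv} }.

(* The transition map d o c^-1 is smooth on c(dom c `&` dom d). *)
Definition smooth_transition (R : realType) (n : nat) (M : topologicalType)
    (c d : chart R n M) : Prop :=
  smooth_on (chart_cod c `&` [set x | chart_dom d (chart_inv c x)])
            (fun x => chart_map d (chart_inv c x)).

(* The smooth structure is given by an atlas, not required to be maximal:
   smooth functions are the same for an atlas and for the maximal atlas that
   contains it. *)
Record smoothManifold (R : realType) (n : nat) := SmoothManifold {
  manifold_space :> topologicalType;
  manifold_hausdorff : hausdorff_space manifold_space;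
  manifold_second_countable : @second_countable manifold_space;
  atlas : set (chart R n manifold_space);
  atlas_cover : forall p, exists2 c, atlas c & chart_dom c p;
  atlas_compatible :
    forall c d, atlas c -> atlas d -> smooth_transition c d }.

Definition is_smooth (R : realType) (n : nat) (M : smoothManifold R n)
    (f : M -> R) : Prop :=
  forall c, @atlas R n M c ->
    smooth_on (chart_cod c) (fun x => f (chart_inv c x)).

Section SmoothClosure.
Variables (R : realType) (n : nat).
Implicit Types (U : set 'rV[R]_n) (f g : 'rV[R]_n -> R).

Lemma CkP (W : normedModType R) k U (f : 'rV[R]_n -> W) :
  Ck k.+1 U f <->
  (forall x, U x -> {for x, continuous f}) /\
  (forall i : 'I_n,
      (forall x, U x -> derivable f x (delta_mx 0 i)) /\
      Ck k U (fun x => 'D_(delta_mx 0 i) f x)).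
Proof. by []. Qed.

Lemma Ck_continuous (W : normedModType R) k U (f : 'rV[R]_n -> W) :
  Ck k U f -> forall x, U x -> {for x, continuous f}.
Proof. by case: k => [|k] []. Qed.

Lemma Ck_pred (W : normedModType R) k U (f : 'rV[R]_n -> W) :
  Ck k.+1 U f -> Ck k U f.
Proof.
elim: k f => [|k IH] f; first by case.
move=> /CkP[cf df]; apply/CkP; split=> // i.
by have [dfi cfi] := df i; split=> //; exact: IH.
Qed.

Lemma eq_continuous_at (W : normedModType R) U (f g : 'rV[R]_n -> W) x :
  open U -> U x -> (forall y, U y -> f y = g y) ->
  {for x, continuous f} -> {for x, continuous g}.
Proof.
move=> oU Ux fg cf; rewrite /prop_for /continuous_at -(fg x Ux).
apply: cvg_trans cf; apply: (@near_eq_cvg _ _ (nbhs x) _ f g).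
by near=> y; apply: fg; near: y; exact: open_nbhs_nbhs.
Unshelve. all: by end_near. Qed.

Lemma Ck_eq (W : normedModType R) k U (f g : 'rV[R]_n -> W) : open U ->
  (forall x, U x -> f x = g x) -> Ck k U f -> Ck k U g.
Proof.
move=> oU; elim: k f g => [|k IH] f g fg.
  by case=> cf _; split=> // x Ux; exact: eq_continuous_at oU Ux fg (cf x Ux).
move=> /CkP[cf df].
have nfg x : U x -> \forall y \near x, f y = g y.
  by move=> Ux; near=> y; apply: fg; near: y; exact: open_nbhs_nbhs.
apply/CkP; split=> [x Ux|i]; first exact: eq_continuous_at oU Ux fg (cf x Ux).
have [dfi cfi] := df i; split=> [x Ux|].
  exact: near_eq_derivable (nfg x Ux) (dfi x Ux).
by apply: IH cfi => x Ux; exact: near_eq_derive (nfg x Ux).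
Unshelve. all: by end_near. Qed.

Lemma Ck_cst k U (a : R) : Ck k U (cst a : 'rV[R]_n -> R).
Proof.
have ca (b : R) (x : 'rV[R]_n) : {for x, continuous (cst b : 'rV[R]_n -> R)}.
  exact: cst_continuous.
elim: k a => [|k IH] a; first by split=> // x _; exact: ca.
apply/CkP; split=> [x _|i]; first exact: ca.
split=> [x _|]; first exact: derivable_cst.
have -> : (fun x => 'D_(delta_mx 0 i) (cst a : 'rV[R]_n -> R) x) = cst 0.
  by apply/funext => x; rewrite derive_cst.
exact: IH.
Qed.

Lemma CkD k U f g : open U -> Ck k U f -> Ck k U g -> Ck k U (f + g).
Proof.
move=> oU; have cD (h1 h2 : 'rV[R]_n -> R) x :
    {for x, continuous h1} -> {for x, continuous h2} ->
    {for x, continuous (h1 + h2)}.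
  by move=> c1 c2; exact: (@continuousD _ _ _ h1 h2 x c1 c2).
elim: k f g => [|k IH] f g.
  by move=> [cf _] [cg _]; split=> // x Ux; exact: cD _ _ _ (cf x Ux) (cg x Ux).
move=> /CkP[cf df] /CkP[cg dg]; apply/CkP; split=> [x Ux|i].
  exact: cD _ _ _ (cf x Ux) (cg x Ux).
have [dfi cfi] := df i; have [dgi cgi] := dg i; split=> [x Ux|].
  by apply: derivableD; [exact: dfi|exact: dgi].
apply: Ck_eq (IH _ _ cfi cgi) => // x Ux.
by rewrite deriveD; [by []|exact: dfi|exact: dgi].
Qed.

Lemma CkM k U f g : open U -> Ck k U f -> Ck k U g -> Ck k U (f * g).
Proof.
move=> oU; have cM (h1 h2 : 'rV[R]_n -> R) x :
    {for x, continuous h1} -> {for x, continuous h2} ->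
    {for x, continuous (h1 * h2)}.
  by move=> c1 c2; exact: (@continuousM _ _ h1 h2 x c1 c2).
elim: k f g => [|k IH] f g.
  by move=> [cf _] [cg _]; split=> // x Ux; exact: cM _ _ _ (cf x Ux) (cg x Ux).
move=> Cf Cg; have [/CkP[cf df] /CkP[cg dg]] := (Cf, Cg).
apply/CkP; split=> [x Ux|i]; first exact: cM _ _ _ (cf x Ux) (cg x Ux).
have [dfi cfi] := df i; have [dgi cgi] := dg i; split=> [x Ux|].
  by apply: derivableM; [exact: dfi|exact: dgi].
apply: Ck_eq (CkD oU (IH _ _ (Ck_pred Cf) cgi) (IH _ _ (Ck_pred Cg) cfi)) => //.
by move=> x Ux; rewrite deriveM; [by []|exact: dfi|exact: dgi].
Qed.

End SmoothClosure.

Section SmoothFunctions.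
Variables (R : realType) (n : nat) (M : smoothManifold R n).

Definition smooth_pred : {pred M -> R} := mem [set f | @is_smooth R n M f].

Lemma is_smooth_cst (a : R) : @is_smooth R n M (cst a).
Proof. by move=> c _ k; exact: Ck_cst. Qed.

Lemma is_smoothD (f g : M -> R) :
  is_smooth f -> is_smooth g -> is_smooth (f + g).
Proof.
by move=> sf sg c Mc k; apply: CkD (sf c Mc k) (sg c Mc k); exact: chart_cod_open.
Qed.

Lemma is_smoothM (f g : M -> R) :
  is_smooth f -> is_smooth g -> is_smooth (f * g).
Proof.
by move=> sf sg c Mc k; apply: CkM (sf c Mc k) (sg c Mc k); exact: chart_cod_open.
Qed.

Lemma is_smoothZ (a : R) (f : M -> R) : is_smooth f -> is_smooth (a *: f).
Proof. by move=> sf; exact: is_smoothM (is_smooth_cst a) sf. Qed.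

Lemma is_smoothN (f : M -> R) : is_smooth f -> is_smooth (- f).
Proof. by move=> sf; rewrite -scaleN1r; exact: is_smoothZ. Qed.

Lemma smooth_subring_closed : subring_closed smooth_pred.
Proof.
split=> [|f g|f g]; rewrite !inE /=.
- exact: is_smooth_cst.
- by move=> sf sg; apply: is_smoothD => //; exact: is_smoothN.
- exact: is_smoothM.
Qed.
HB.instance Definition _ :=
  GRing.isSubringClosed.Build (M -> R) smooth_pred smooth_subring_closed.

Lemma smooth_scaler_closed : scaler_closed smooth_pred.
Proof. by move=> a f; rewrite !inE; exact: is_smoothZ. Qed.
HB.instance Definition _ :=
  GRing.isScaleClosed.Build R (M -> R) smooth_pred smooth_scaler_closed.

Record smoothFun := SmoothFun {
  smooth_fun :> M -> R;
  _ : smooth_fun \in smooth_pred }.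

HB.instance Definition _ := [isSub for smooth_fun].
HB.instance Definition _ := [Choice of smoothFun by <:].
HB.instance Definition _ :=
  GRing.SubChoice_isSubComPzRing.Build _ _ smoothFun (subringClosedP _).
HB.instance Definition _ := [SubZmodule_isSubLmodule of smoothFun by <:].

Lemma smooth_funP (f : smoothFun) : is_smooth f.
Proof. by have := valP f; rewrite inE. Qed.

Definition mk_smooth (f : M -> R) (sf : is_smooth f) : smoothFun :=
  SmoothFun (mem_set sf).

End SmoothFunctions.

Section VectorFields.
Variables (R : realType) (n : nat) (M : smoothManifold R n).
Implicit Types (p : M) (f g : smoothFun M).

Definition point_derivation p (v : smoothFun M -> R) : Prop :=
  (forall (a : R) f g, v (a *: f + g) = a * v f + v g) /\
  (forall f g, v (f * g) = v f * g p + f p * v g).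

(* T_p M is taken to be the space of point derivations of C^oo(M) at p. *)
Record tangentVector p := TangentVector {
  tangent_fun :> smoothFun M -> R;
  tangentP : point_derivation p tangent_fun }.

(* A vector field is a section p |-> X p of the tangent bundle; it is smooth
   when p |-> X p f is smooth for every smooth f. *)
Record vectorField := VectorField {
  vfield_at :> forall p, tangentVector p;
  vfield_smooth : forall f, is_smooth (fun p => vfield_at p f) }.

Lemma tangentVector_eq p (v w : tangentVector p) :
  (forall f, v f = w f) -> v = w.
Proof.
case: v w => [v Pv] [w Pw] /= vw; have evw : v = w by apply/funext.
by case: _ / evw Pw => Pw; congr TangentVector; exact: Prop_irrelevance.
Qed.

Lemma vectorField_eq (X Y : vectorField) :
  (forall p f, X p f = Y p f) -> X = Y.
Proof.
case: X Y => [X PX] [Y PY] /= XY.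
have eXY : X = Y.
  by apply/functional_extensionality_dep => p; exact: tangentVector_eq.
by case: _ / eXY PY => PY; congr VectorField; exact: Prop_irrelevance.
Qed.

(* The function X(f). *)
Definition vf_app (X : vectorField) f : smoothFun M :=
  mk_smooth (vfield_smooth X f).

Lemma vf_appE X f p : vf_app X f p = X p f. Proof. by []. Qed.

Section MkVectorField.
Variables (D : smoothFun M -> smoothFun M).
Hypothesis linD : forall (a : R) f g, D (a *: f + g) = a *: D f + D g.
Hypothesis leibD : forall f g, D (f * g) = D f * g + f * D g.

Lemma derivation_at p : point_derivation p (fun f => D f p).
Proof. by split=> [a f g|f g]; rewrite (linD, leibD). Qed.

Definition vf_of_derivation : vectorField :=
  @VectorField (fun p => TangentVector (derivation_at p))
               (fun f => smooth_funP (D f)).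

End MkVectorField.

End VectorFields.

Section VectorFieldModule.
Variables (R : realType) (n : nat) (M : smoothManifold R n).
Implicit Types (X Y Z : vectorField M) (f g h : smoothFun M) (p : M).

HB.instance Definition _ := gen_eqMixin (vectorField M).
HB.instance Definition _ := gen_choiceMixin (vectorField M).

Lemma smoothFun_eq f g : (forall p, f p = g p) -> f = g.
Proof. by move=> fg; apply/val_inj/funext. Qed.

Lemma vf_app_lin X (a : R) f g :
  vf_app X (a *: f + g) = a *: vf_app X f + vf_app X g.
Proof. by apply: smoothFun_eq => p; exact: (tangentP (X p)).1. Qed.

Lemma vf_appM X f g : vf_app X (f * g) = vf_app X f * g + f * vf_app X g.
Proof. by apply: smoothFun_eq => p; exact: (tangentP (X p)).2. Qed.

Lemma vf_appD X f g : vf_app X (f + g) = vf_app X f + vf_app X g.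
Proof. by have := vf_app_lin X 1 f g; rewrite !scale1r. Qed.

Lemma vf_appB X f g : vf_app X (f - g) = vf_app X f - vf_app X g.
Proof.
by rewrite addrC -scaleN1r vf_app_lin scaleN1r addrC.
Qed.

Lemma smoothFun_scaleE (a : R) f p : (a *: f) p = a * f p.
Proof. by []. Qed.

Lemma smoothFun_addE f g p : (f + g) p = f p + g p.
Proof. by []. Qed.

Lemma smoothFun_oppE f p : (- f) p = - f p.
Proof. by []. Qed.

Lemma smoothFun_mulE f g p : (f * g) p = f p * g p.
Proof. by []. Qed.

Let sfE :=
  (smoothFun_scaleE, smoothFun_addE, smoothFun_oppE, smoothFun_mulE).

Fact zero_lin (a : R) f g : (0 : smoothFun M) = a *: 0 + 0.
Proof. by rewrite scaler0 addr0. Qed.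
Fact zero_leib f g : (0 : smoothFun M) = 0 * g + f * 0.
Proof. by rewrite mul0r mulr0 addr0. Qed.
Definition vf_zero : vectorField M :=
  @vf_of_derivation R n M (fun=> 0) zero_lin zero_leib.

Fact opp_lin X (a : R) f g :
  - vf_app X (a *: f + g) = a *: (- vf_app X f) + - vf_app X g.
Proof. by rewrite vf_app_lin opprD scalerN. Qed.
Fact opp_leib X f g :
  - vf_app X (f * g) = - vf_app X f * g + f * - vf_app X g.
Proof. by rewrite vf_appM opprD mulNr mulrN. Qed.
Definition vf_opp X : vectorField M := vf_of_derivation (opp_lin X) (opp_leib X).

Fact add_lin X Y (a : R) f g :
  vf_app X (a *: f + g) + vf_app Y (a *: f + g) =
  a *: (vf_app X f + vf_app Y f) + (vf_app X g + vf_app Y g).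
Proof. by rewrite !vf_app_lin scalerDr addrACA. Qed.
Fact add_leib X Y f g :
  vf_app X (f * g) + vf_app Y (f * g) =
  (vf_app X f + vf_app Y f) * g + f * (vf_app X g + vf_app Y g).
Proof. by rewrite !vf_appM mulrDl mulrDr addrACA. Qed.
Definition vf_add X Y : vectorField M := vf_of_derivation (add_lin X Y) (add_leib X Y).

Fact scale_lin h X (a : R) f g :
  h * vf_app X (a *: f + g) = a *: (h * vf_app X f) + h * vf_app X g.
Proof.
by apply: smoothFun_eq => p; rewrite vf_app_lin !sfE mulrDr mulrCA.
Qed.
Fact scale_leib h X f g :
  h * vf_app X (f * g) = h * vf_app X f * g + f * (h * vf_app X g).
Proof. by rewrite vf_appM mulrDr mulrA [h * (f * _)]mulrCA. Qed.
Definition vf_scale h X : vectorField M :=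
  vf_of_derivation (scale_lin h X) (scale_leib h X).

Fact bracket_lin X Y (a : R) f g :
  vf_app X (vf_app Y (a *: f + g)) - vf_app Y (vf_app X (a *: f + g)) =
  a *: (vf_app X (vf_app Y f) - vf_app Y (vf_app X f)) +
  (vf_app X (vf_app Y g) - vf_app Y (vf_app X g)).
Proof. by rewrite !vf_app_lin opprD addrACA scalerBr. Qed.
Fact bracket_leib X Y f g :
  vf_app X (vf_app Y (f * g)) - vf_app Y (vf_app X (f * g)) =
  (vf_app X (vf_app Y f) - vf_app Y (vf_app X f)) * g +
  f * (vf_app X (vf_app Y g) - vf_app Y (vf_app X g)).
Proof.
apply: smoothFun_eq => p; rewrite !(vf_appM, vf_appD) !sfE.
by ring.
Qed.
(* The Lie bracket: [X, Y](f) = X(Y(f)) - Y(X(f)). *)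
Definition bracket X Y : vectorField M :=
  vf_of_derivation (bracket_lin X Y) (bracket_leib X Y).

Fact vf_addA : associative vf_add.
Proof. by move=> X Y Z; apply: vectorField_eq => p f; exact: addrA. Qed.
Fact vf_addC : commutative vf_add.
Proof. by move=> X Y; apply: vectorField_eq => p f; exact: addrC. Qed.
Fact vf_add0 : left_id vf_zero vf_add.
Proof. by move=> X; apply: vectorField_eq => p f; exact: add0r. Qed.
Fact vf_addN : left_inverse vf_zero vf_opp vf_add.
Proof. by move=> X; apply: vectorField_eq => p f; exact: addNr. Qed.

HB.instance Definition _ :=
  GRing.isZmodule.Build (vectorField M) vf_addA vf_addC vf_add0 vf_addN.

Fact vf_scaleA f g X : vf_scale f (vf_scale g X) = vf_scale (f * g) X.
Proof. by apply: vectorField_eq => p h; exact: mulrA. Qed.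
Fact vf_scale1 : left_id 1 vf_scale.
Proof. by move=> X; apply: vectorField_eq => p h; exact: mul1r. Qed.
Fact vf_scaleDr : right_distributive vf_scale +%R.
Proof. by move=> f X Y; apply: vectorField_eq => p h; exact: mulrDr. Qed.
Fact vf_scaleDl X : {morph vf_scale^~ X : f g / f + g}.
Proof. by move=> f g; apply: vectorField_eq => p h; exact: mulrDl. Qed.

HB.instance Definition _ := GRing.Zmodule_isLmodule.Build (smoothFun M) (vectorField M)
  vf_scaleA vf_scale1 vf_scaleDr vf_scaleDl.

(* Multiplication of a vector field by a real number, seen as a constant
   function. *)
Definition rscale (a : R) X : vectorField M := (a *: (1 : smoothFun M)) *: X.

Definition real_bilinear_on (D : set (vectorField M)) (nabla : vectorField M -> vectorField M -> vectorField M) :=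
  (forall (a : R) X X' Y, D X -> D X' -> D Y ->
     nabla (rscale a X + X') Y = rscale a (nabla X Y) + nabla X' Y) /\
  (forall (a : R) X Y Y', D X -> D Y -> D Y' ->
     nabla X (rscale a Y + Y') = rscale a (nabla X Y) + nabla X Y').

(* A covariant derivative on the submodule D: nabla X Y need not belong to D,
   and its values for X or Y outside D are irrelevant. *)
Record submodule_covariant_derivative (D : set (vectorField M))
    (nabla : vectorField M -> vectorField M -> vectorField M) : Prop := SubmoduleCovariantDerivative {
  scd_bilinear : real_bilinear_on D nabla;
  scd_tensorial : forall f X Y, D X -> D Y ->
    nabla (f *: X) Y = f *: nabla X Y;
  scd_leibniz : forall f X Y, D X -> D Y ->
    nabla X (f *: Y) = vf_app X f *: Y + f *: nabla X Y }.

(* nabla is only meant to be applied to arguments in the image of P. *)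
Definition extension (P : vectorField M -> vectorField M) (nabla : vectorField M -> vectorField M -> vectorField M)
    (X Y : vectorField M) : vectorField M :=
  nabla (P X) Y + P (bracket (X - P X) Y).

Definition sum_connection (N : nat) (P : 'I_N -> vectorField M -> vectorField M)
    (nabla : 'I_N -> vectorField M -> vectorField M -> vectorField M)
    (X Y : vectorField M) : vectorField M :=
  \sum_(A < N) extension (P A) (nabla A) X (P A Y).

End VectorFieldModule.

(* Main.v *)
Require Import Defs.
From mathcomp Require Import all_boot all_order all_algebra.
From mathcomp Require Import all_classical all_reals.
Import GRing.Theory.
Local Open Scope classical_set_scope.
Local Open Scope ring_scope.

(** [P([X - P X, Y])] is tensorial in [X] because the defect [Y(f) (X - P X)]
    of [[f (X - P X), Y] = f [X - P X, Y] - Y(f) (X - P X)] is killed by the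
    idempotent [P]. In the second argument, [nabla (P X)] contributes the
    derivation term [(P X)(f) Y] and the bracket contributes
    [(X - P X)(f) P Y]; as [P Y = Y] they add up to [X(f) Y]. Summing over the
    projectors and using [\sum_A P_A Y = Y] gives the theorem. *)

Section BracketRules.
Variables (R : realType) (n : nat) (M : smoothManifold R n).
Implicit Types (X Y Z : vectorField M) (f : smoothFun M).

Lemma vf_app_addl X Y f : vf_app (X + Y) f = vf_app X f + vf_app Y f.
Proof. exact: smoothFun_eq. Qed.

Lemma vf_app_scalel f X g : vf_app (f *: X) g = f * vf_app X g.
Proof. exact: smoothFun_eq. Qed.

Lemma vf_app_oppl X f : vf_app (- X) f = - vf_app X f.
Proof. exact: smoothFun_eq. Qed.

Lemma vf_app_bracket X Y f :
  vf_app (bracket X Y) f = vf_app X (vf_app Y f) - vf_app Y (vf_app X f).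
Proof. exact: smoothFun_eq. Qed.

(** Brackets are defined by their action on functions, so the identities below are checked there. *)
Lemma vf_app_inj X Y : (forall f, vf_app X f = vf_app Y f) -> X = Y.
Proof.
by move=> XY; apply: vectorField_eq => p f; rewrite -!vf_appE XY.
Qed.

Lemma bracketDl X Y Z : bracket (X + Y) Z = bracket X Z + bracket Y Z.
Proof.
apply: vf_app_inj => g; rewrite vf_app_addl !vf_app_bracket !vf_app_addl.
by rewrite vf_appD opprD addrACA.
Qed.

(** Antisymmetry transfers a rule proved for one slot of the bracket to the other slot. *)
Lemma bracketC X Y : bracket X Y = - bracket Y X.
Proof. by apply: vf_app_inj => g; rewrite vf_app_oppl !vf_app_bracket opprB. Qed.

Lemma bracketDr X Y Z : bracket X (Y + Z) = bracket X Y + bracket X Z.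
Proof. by rewrite bracketC bracketDl opprD -!bracketC. Qed.

Lemma bracketZr f X Y : bracket X (f *: Y) = vf_app X f *: Y + f *: bracket X Y.
Proof.
apply: vf_app_inj => g.
rewrite vf_app_addl !vf_app_scalel !vf_app_bracket !vf_app_scalel.
by rewrite vf_appM mulrBr addrA.
Qed.

Lemma bracketZl f X Y : bracket (f *: X) Y = f *: bracket X Y - vf_app Y f *: X.
Proof. by rewrite bracketC bracketZr opprD addrC -scalerN -bracketC. Qed.

(** Since [1 = 1 * 1], the Leibniz rule gives [X(1) = X(1) + X(1)]. *)
Lemma vf_app1 X : vf_app X 1 = 0.
Proof.
have := vf_appM X 1 1; rewrite !mulr1 mul1r => /eqP.
by rewrite -subr_eq subrr eq_sym => /eqP.
Qed.

(** Because constants have zero derivative, the Leibniz rule specialises to real homogeneity in the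
    second argument. *)
Lemma vf_app_real X (a : R) : vf_app X (a *: (1 : smoothFun M)) = 0.
Proof.
have := vf_app_lin X a 1 0; rewrite vf_app1 scaler0 addr0 add0r => ->.
by have := vf_appB X 0 0; rewrite !subrr.
Qed.

(** Taking [a = 1] in [real_bilinear_on], which treats sums and real multiples jointly, isolates
    additivity. *)
Lemma rscale1 X : rscale 1 X = X.
Proof. by rewrite /rscale !scale1r. Qed.

End BracketRules.

Section Extension.
Variables (R : realType) (n : nat) (M : smoothManifold R n).
Implicit Types (X Y : vectorField M) (f : smoothFun M).
Variables (P : {linear vectorField M -> vectorField M}).
Variables (nabla : vectorField M -> vectorField M -> vectorField M).
Hypothesis P_idem : forall X, P (P X) = P X.
Hypothesis nabla_scd : submodule_covariant_derivative (range P) nabla.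

(** The second argument has the form [P Y] because the rules of [nabla] hold only on [range P];
    membership is then [imageT]. *)
Lemma extensionDl X X' Y :
  extension P nabla (X + X') (P Y) =
  extension P nabla X (P Y) + extension P nabla X' (P Y).
Proof.
have [[addl _] _ _] := nabla_scd.
have nablaDl : nabla (P (X + X')) (P Y) = nabla (P X) (P Y) + nabla (P X') (P Y).
  rewrite linearD -[P X]rscale1 addl ?rscale1 //; exact: imageT.
rewrite /extension nablaDl.
by rewrite addrACA -linearD -bracketDl linearD opprD [X - P X + _]addrACA.
Qed.

Lemma extensionDr X Y Y' :
  extension P nabla X (P (Y + Y')) =
  extension P nabla X (P Y) + extension P nabla X (P Y').
Proof.
have [[_ addr] _ _] := nabla_scd.
have nablaDr : nabla (P X) (P (Y + Y')) = nabla (P X) (P Y) + nabla (P X) (P Y').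
  rewrite linearD -[P Y]rscale1 addr ?rscale1 //; exact: imageT.
rewrite /extension nablaDr.
by rewrite linearD bracketDr linearD addrACA.
Qed.

Lemma extensionZl f X Y :
  extension P nabla (f *: X) (P Y) = f *: extension P nabla X (P Y).
Proof.
have [_ tens _] := nabla_scd.
rewrite /extension linearZ tens; try exact: imageT.
(* The defect is a multiple of [X - P X], and [P X - P (P X) = 0]. *)
rewrite -scalerBr bracketZl linearB !linearZ /= linearB P_idem subrr.
by rewrite oppr0 scaler0 addr0 scalerDr.
Qed.

Lemma extensionZr f X Y :
  extension P nabla X (P (f *: Y)) =
  vf_app X f *: P Y + f *: extension P nabla X (P Y).
Proof.
have [_ _ leib] := nabla_scd.
rewrite /extension linearZ leib; try exact: imageT.
rewrite bracketZr linearD !linearZ /= P_idem addrACA -scalerDl -scalerDr.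
(* The coefficients of [P Y] combine through [P X + (X - P X) = X]. *)
by rewrite -vf_app_addl [P X + _]addrC subrK.
Qed.

End Extension.

Theorem theorem2p2 (R : realType) (n : nat) (M : smoothManifold R n) (N : nat)
    (P : 'I_N -> {linear vectorField M -> vectorField M})
    (P_idem : forall (A : 'I_N) (X : vectorField M), P A (P A X) = P A X)
    (P_orth : forall A B : 'I_N, A != B ->
       forall X : vectorField M, P A (P B X) = 0)
    (P_sum : forall X : vectorField M, \sum_(A < N) P A X = X)
    (nablaA : 'I_N -> vectorField M -> vectorField M -> vectorField M)
    (nablaA_scd : forall A : 'I_N,
       submodule_covariant_derivative (range (P A)) (nablaA A)) :
  let nabla := sum_connection (fun A => P A : vectorField M -> vectorField M)
                 nablaA in
  [/\ forall (a : R) (X X' Y : vectorField M),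
         nabla (rscale a X + X') Y = rscale a (nabla X Y) + nabla X' Y,
      forall (a : R) (X Y Y' : vectorField M),
         nabla X (rscale a Y + Y') = rscale a (nabla X Y) + nabla X Y',
      forall (f : smoothFun M) (X Y : vectorField M),
         nabla (f *: X) Y = f *: nabla X Y
    & forall (f : smoothFun M) (X Y : vectorField M),
         nabla X (f *: Y) = vf_app X f *: Y + f *: nabla X Y].
Proof.
move=> nabla.
(* Real scaling is scaling by a constant function, so additivity and the two rules for [f] suffice
   for all four claims. *)
have nablaDl X X' Y : nabla (X + X') Y = nabla X Y + nabla X' Y.
  rewrite -big_split; apply: eq_bigr => A _.
  exact: extensionDl (nablaA_scd A) X X' Y.
have nablaDr X Y Y' : nabla X (Y + Y') = nabla X Y + nabla X Y'.
  rewrite -big_split; apply: eq_bigr => A _.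
  exact: extensionDr (nablaA_scd A) X Y Y'.
have nablaZl f X Y : nabla (f *: X) Y = f *: nabla X Y.
  rewrite scaler_sumr; apply: eq_bigr => A _.
  exact: extensionZl (P_idem A) (nablaA_scd A) f X Y.
have nablaZr f X Y : nabla X (f *: Y) = vf_app X f *: Y + f *: nabla X Y.
  (* Only the [Y] multiplied by [vf_app X f] is decomposed, so that each index receives its own
     Leibniz term [vf_app X f *: P A Y]. *)
  rewrite -[X in _ *: X + _]P_sum !scaler_sumr -big_split.
  apply: eq_bigr => A _; exact: extensionZr (P_idem A) (nablaA_scd A) f X Y.
split=> // [a X X' Y|a X Y Y']; first by rewrite nablaDl nablaZl.
by rewrite nablaDr nablaZr vf_app_real scale0r add0r.
Qed.
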